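(* For any $A \subseteq \Omega_\kappa$ it holds that $$\mathbb{P}_\kappa(A)\, \mathbb{E}_\kappa \exp\Big( \frac{d_T(\cdot, A)^2}{144} \Big) \le 1.$$
   Context: Let $L \ge 2$ be an integer, $\kappa = (\kappa_1,\ldots,\kappa_L)$ a vector of positive integers, $N = \kappa_1 + \cdots + \kappa_L$, and $\mathcal{X} = \{x_1,\ldots,x_L\} \subset \mathbb{R}$ a set of $L$ distinct reals. The multislice is $\Omega_\kappa = \{\omega \in \mathcal{X}^N : \#\{i : \omega_i = x_\ell\} = \kappa_\ell \text{ for } \ell = 1,\ldots,L\}$, with uniform distribution $\mathbb{P}_\kappa$ and expectation $\mathbb{E}_\kappa$. Talagrand's convex distance between $\omega$ and $A$ is $$d_T(\omega, A) := \sup_{\alpha \in \mathbb{R}^N : |\alpha| = 1}\ \inf_{\omega' \in A} \sum_{i=1}^N |\alpha_i|\, \mathbf{1}_{\{\omega_i \neq \omega'_i\}},$$ where $|\alpha|$ is the Euclidean norm. For $A = \emptyset$ the left-hand side of the inequality is read as $0$. *)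

(* Defs.v *)
From mathcomp Require Import all_boot all_order all_algebra finmap.
From mathcomp Require Import all_classical all_reals all_analysis.

Set Implicit Arguments.
Unset Strict Implicit.
Unset Printing Implicit Defensive.

Import Order.TTheory GRing.Theory Num.Theory.

Local Open Scope classical_set_scope.
Local Open Scope ring_scope.

Definition multislice (R : realType) (L N : nat) (kappa : 'I_L -> nat)
    (x : 'I_L -> R) : set 'rV[R]_N :=
  [set w | (forall i, range x (w ord0 i)) /\
           (forall l, #|[pred i | w ord0 i == x l]| = kappa l)].

(* [fset_set] and [\sum_(_ \in _)] have default values on infinite sets; this
   shows that they are not reached on a multislice or on a subset of it. *)
Lemma finite_multislice (R : realType) (L N : nat) (kappa : 'I_L -> nat)
    (x : 'I_L -> R) : finite_set (multislice (N := N) kappa x).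
Proof.
apply: (@sub_finite_set _ _
  [set \row_i x (s i) | s in [set: {ffun 'I_N -> 'I_L}]]); last first.
  exact/finite_image/finite_finset.
move=> w [wx _].
have /boolp.choice[s sE] : forall i, exists l, x l = w ord0 i.
  by move=> i; have [l _ xl] := wx i; exists l.
exists (finfun s) => //=.
by apply/rowP => i; rewrite mxE ffunE sE.
Qed.

Definition unif_prob (R : realType) (T : choiceType) (Omega A : set T) : R :=
  #|` fset_set (A `&` Omega)|%:R / #|` fset_set Omega|%:R.

Definition unif_expect (R : realType) (T : choiceType) (Omega : set T)
    (f : T -> R) : R :=
  (\sum_(w \in Omega) f w) / #|` fset_set Omega|%:R.

(* The norm [`|a|] of MathComp-Analysis on row vectors is the sup norm. *)
Definition euclid_norm (R : realType) (N : nat) (a : 'rV[R]_N) : R :=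
  Num.sqrt (\sum_(i < N) a ord0 i ^+ 2).

(* The infimum of the empty set of reals is [0] in the library, so the distance
   to the empty set is [0]; for nonempty [A] and [0 < N] the infima and the
   supremum are those of nonempty bounded sets. *)
Definition convex_dist (R : realType) (N : nat) (w : 'rV[R]_N)
    (A : set 'rV[R]_N) : R :=
  sup [set inf [set \sum_(i < N) `|a ord0 i| * (w ord0 i != w' ord0 i)%:R
               | w' in A]
      | a in [set a : 'rV[R]_N | euclid_norm a = 1]].

(* Main.v *)
Require Import Defs.
From mathcomp Require Import all_boot all_order all_algebra all_fingroup finmap.
From mathcomp Require Import all_classical all_reals all_analysis.
From mathcomp Require Import ring lra.

(** The multislice is an orbit of the symmetric group 'S_N acting on words, so
    averages over it are averages over 'S_N.  The inequality holds because the
    squared convex distance [g] is self-bounding under transpositions: the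
    positive parts of its [N ^ 2] increments have squares adding up to at most
    [28 N g], and each increment is at most 2
    ([convex_dist_sq_selfbounding], [convex_dist_sq_tperm_le]).  The first bound
    comes from a near-optimal weight [alpha] at the word: transposing [i] and [j]
    lowers the distance by at most about [|alpha_i| + |alpha_j|].  The second
    comes from splitting a unit weight into its two coordinates and the rest, by
    the Cauchy-Schwarz inequality.

    On 'S_N the entropy of a positive function satisfies a modified logarithmic
    Sobolev inequality for random transpositions ([mlsi_on]), proved as by Gao
    and Quastel by induction on the set of positions that are permuted.  For
    [expR (t * g)] with [|t| <= 1/4] it turns self-boundedness into
    [t F' - F ln F <= 56 t ^ 2 F'], where [F] is the moment generating function
    of [g] ([selfbounding_entropy_le]).  This differential inequality says that
    [(1 / t - 56) * ln F t] is nonincreasing, also across [t = 0], where it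
    extends continuously ([herbst]).  Comparing [t = 1/144] with [t = -1/4]
    gives [88 ln F(1/144) <= -60 ln F(-1/4)], hence [F(1/144) F(-1/4) <= 1]
    ([selfbounding_mgf_le]).  As [g] vanishes on [A], [F(-1/4)] is at least the
    probability of [A]. *)

Set Implicit Arguments.
Unset Strict Implicit.
Unset Printing Implicit Defensive.

Import Order.TTheory GRing.Theory Num.Theory.
Import numFieldNormedType.Exports.

Local Open Scope classical_set_scope.
Local Open Scope ring_scope.

(** * The entropy of a function on the symmetric group *)

(** Compare each term with its tangent: [ln u <= u - 1] at
    [u = (A / B) * b i / a i], where [A] and [B] are the two sums.  With [a]
    constant it is the concavity of [ln]; in general it is the joint convexity
    of relative entropy. *)
Lemma log_sum (R : realType) (I : finType) (P : pred I) (i0 : I)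
    (a b : I -> R) :
  P i0 -> (forall i, 0 < a i) -> (forall i, 0 < b i) ->
  (\sum_(i | P i) a i) * (ln (\sum_(i | P i) a i) - ln (\sum_(i | P i) b i))
  <= \sum_(i | P i) a i * (ln (a i) - ln (b i)).
Proof.
move=> Pi0 a_gt0 b_gt0.
have sum_gt0 c : (forall i, 0 < c i) -> 0 < \sum_(i | P i) c i :> R.
  move=> c_gt0; rewrite (bigD1 i0)//= ltr_wpDr ?c_gt0//.
  by apply: sumr_ge0 => i _; exact/ltW.
set A := \sum_(i | P i) a i; set B := \sum_(i | P i) b i.
have A0 : 0 < A by exact: sum_gt0.
have B0 : 0 < B by exact: sum_gt0.
have [k [k0 lnk kB]] : exists k, [/\ 0 < k, ln k = ln A - ln B & k * B = A].
  by exists (A / B); rewrite divr_gt0// ln_div// divfK ?gt_eqF.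
have le_i i : P i -> a i - k * b i + a i * ln k <= a i * (ln (a i) - ln (b i)).
  move=> _; have ai := a_gt0 i; have bi := b_gt0 i.
  pose t := k * b i / a i.
  have t0 : 0 < t by rewrite divr_gt0// mulr_gt0.
  have lnt : ln t = ln k + ln (b i) - ln (a i).
    by rewrite /t ln_div ?posrE ?mulr_gt0// (@lnM _ k) ?posrE//; lra.
  have : ln t <= t - 1.
    by have := @le_ln1Dx R (t - 1); rewrite [1 + _]addrC subrK; apply; lra.
  have ta : t * a i = k * b i by rewrite divfK ?gt_eqF.
  by rewrite -(ler_pM2l ai) lnt => lt_t; lra.
apply: le_trans (ler_sum _ le_i).
rewrite big_split/= sumrB -mulr_suml -mulr_sumr -/A -/B lnk.
by rewrite kB subrr add0r.
Qed.

(** The conditional expectation of [f] given the values outside [I], when the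
    symmetric group acts on positions by left multiplication. *)
Definition sym_avg {R : realType} {n : nat} (I : {set 'I_n}) (f : 'S_n -> R)
    (s : 'S_n) : R :=
  (\sum_(r : 'S_n | perm_on I r) f (r * s)%g) / (#|I|)`!%:R.

Section SymAvg.
Variables (R : realType) (n : nat).
Implicit Types (I : {set 'I_n}) (f h : 'S_n -> R) (s r : 'S_n).

Let fact_gt0R m : 0 < m`!%:R :> R. Proof. by rewrite ltr0n fact_gt0. Qed.

Lemma sym_avg_gt0 I f s : (forall s, 0 < f s) -> 0 < sym_avg I f s.
Proof.
move=> f0; rewrite divr_gt0// (bigD1 1%g) ?perm_on1//= ltr_wpDr//.
by apply: sumr_ge0 => r _; exact/ltW.
Qed.

Lemma sym_avg_card1 I f s : #|I| = 1%N -> sym_avg I f s = f s.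
Proof.
move=> I1; rewrite /sym_avg I1 divr1 (big_pred1 1%g) ?mul1g// => r /=.
apply/idP/eqP => [rI|->]; last exact: perm_on1.
by apply: perm_on_id rI _; rewrite I1.
Qed.

Lemma sym_avg_setT f s : sym_avg [set: 'I_n]%SET f s = (\sum_t f t) / n`!%:R.
Proof.
rewrite /sym_avg cardsT card_ord; congr (_ / _).
rewrite [RHS](reindex_inj (mulIg s))/=; apply: eq_bigl => r.
by apply/fintype.subsetP => i _; rewrite inE.
Qed.

Lemma sym_avg_inv I f r s : perm_on I r ->
  sym_avg I f (r * s)%g = sym_avg I f s.
Proof.
move=> rI; congr (_ / _); rewrite [RHS](reindex_inj (mulIg r))/=.
apply: eq_big => [t|t _]; last by rewrite mulgA.
apply/idP/idP => [tI|trI]; first exact: perm_onM.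
by rewrite -[t](mulgK r); apply: perm_onM => //; exact: perm_onV.
Qed.

(** The averaging operator is self-adjoint and fixes [h]. *)
Lemma sum_sym_avgM I f h : (forall r s, perm_on I r -> h (r * s)%g = h s) ->
  \sum_s sym_avg I f s * h s = \sum_s f s * h s.
Proof.
move=> hI.
pose K : R := (#|I|)`!%:R.
transitivity ((\sum_(r : 'S_n | perm_on I r) \sum_s f s * h s) / K).
  transitivity (\sum_s (\sum_(r : 'S_n | perm_on I r) f (r * s)%g * h s) / K).
    by apply: eq_bigr => s _; rewrite /sym_avg mulrAC mulr_suml.
  rewrite -mulr_suml exchange_big/=; congr (_ / _).
  apply: eq_bigr => r rI; rewrite [RHS](reindex_inj (mulgI r))/=.
  by apply: eq_bigr => s _; rewrite hI.
by rewrite sumr_const card_perm -mulr_natr -mulrA divff ?mulr1 ?gt_eqF.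
Qed.

(** The transpositions [tperm i j], for [j] in [I], represent the cosets of the
    permutations of [I :\ i] in those of [I]: the coset of [r] is read off from
    [j = r i]. *)
Lemma sum_perm_on_tperm I (i : 'I_n) (F : 'S_n -> R) : i \in I ->
  \sum_(r : 'S_n | perm_on I r) F r =
  \sum_(j in I) \sum_(r : 'S_n | perm_on (I :\ i) r) F (r * tperm i j)%g.
Proof.
move=> iI; rewrite (partition_big (fun r : 'S_n => r i) (mem I))/=; last first.
  by move=> r rI; rewrite perm_closed.
apply: eq_bigr => j jI; rewrite (reindex_inj (mulIg (tperm i j)))/=.
apply: eq_bigl => r; rewrite permM.
have tI : perm_on I (tperm i j).
  apply: fintype.subset_trans (tperm_on i j) _; apply/fintype.subsetP => k.
  by rewrite !inE => /orP[] /eqP ->.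
apply/andP/idP => [[rI rij]|rI].
  have ri : r i = i.
    by rewrite -[r i](tpermK i j) (eqP rij) tpermR.
  have {}rI : perm_on I r by rewrite -[r](mulgK (tperm i j)) tpermV perm_onM.
  apply/fintype.subsetP => k rk; rewrite !inE (fintype.subsetP rI)// andbT.
  by apply: contraNneq rk => ->; rewrite ri.
have ri : r i = i by rewrite (out_perm rI)// !inE eqxx.
rewrite ri tpermL eqxx; split=> //; apply: perm_onM => //.
by apply: fintype.subset_trans rI _; rewrite subsetDl.
Qed.

Lemma sym_avg_tperm I i f s : i \in I ->
  sym_avg I f s =
  (\sum_(j in I) sym_avg (I :\ i) f (tperm i j * s)%g) / #|I|%:R.
Proof.
move=> iI; rewrite /sym_avg (sum_perm_on_tperm _ iI) -mulr_suml.
have -> : (#|I|)`!%:R = (#|I :\ i|)`!%:R * #|I|%:R :> R.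
  by rewrite [#|I|](cardsD1 i) iI add1n factS natrM mulrC.
rewrite invfM mulrA; congr (_ / _ / _); apply: eq_bigr => j _.
by apply: eq_bigr => r _; rewrite mulgA.
Qed.


(** The contribution of the transposition of [i] and [j] to the Dirichlet form of
    [f] and [ln f]: exchanging [s] and [tperm i j * s] shows that it is half the
    sum of the terms [(f - f') (ln f - ln f')], with [f'] the value after the
    transposition. *)
Definition tperm_entropy f (i j : 'I_n) : R :=
  \sum_s f s * (ln (f s) - ln (f (tperm i j * s)%g)).

(** One step of the induction releases position [i].  The average over [I] is the
    mean over [j] of the average [g] over [I :\ i] moved by [tperm i j], so
    Jensen's inequality bounds the entropy by transposition terms of [g]; the
    log-sum inequality bounds those by the same terms of [f], because conjugation
    by a permutation fixing [i] only relabels [j]. *)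
Lemma sym_avg_entropy_le I i f : i \in I -> (forall s, 0 < f s) ->
  \sum_s f s * (ln (sym_avg (I :\ i) f s) - ln (sym_avg I f s)) <=
  (\sum_(j in I) tperm_entropy f i j) / #|I|%:R.
Proof.
move=> iI f_gt0; set g := sym_avg (I :\ i) f; set m : R := #|I|%:R.
have m_gt0 : 0 < m by rewrite ltr0n; apply/card_gt0P; exists i.
have g_gt0 s : 0 < g s by exact: sym_avg_gt0.
have subI r : perm_on (I :\ i) r -> perm_on I r.
  by move=> rI; apply: fintype.subset_trans rI _; rewrite subsetDl.
rewrite ler_pdivlMr// -(@sum_sym_avgM (I :\ i) f); last first.
  move=> r s rI.
  by rewrite /g (sym_avg_inv _ _ rI) (sym_avg_inv _ _ (subI r rI)).
rewrite -/g mulr_suml.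
have jensen s : g s * (ln (g s) - ln (sym_avg I f s)) * m <=
    \sum_(j in I) g s * (ln (g s) - ln (g (tperm i j * s)%g)).
  rewrite -mulr_sumr -mulrA ler_pM2l// (sym_avg_tperm _ _ iI) -/g -/m.
  have sum_gt0 : 0 < \sum_(j in I) g (tperm i j * s)%g.
    rewrite (bigD1 i)//= ltr_wpDr//.
    by apply: sumr_ge0 => j _; exact/ltW.
  rewrite ln_div//.
  have := @log_sum R _ (mem I) i (fun=> 1) (fun j => g (tperm i j * s)%g) iI.
  rewrite sumr_const -/m => /(_ (fun=> ltr01) (fun=> g_gt0 _)) h.
  rewrite sumrB sumr_const -mulr_natr -/m.
  have := h; under [in X in _ <= X -> _]eq_bigr do rewrite ln1 mul1r sub0r.
  rewrite sumrN => {}h; lra.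
have logsum j s : g s * (ln (g s) - ln (g (tperm i j * s)%g)) <=
    (\sum_(r : 'S_n | perm_on (I :\ i) r) f (r * s)%g *
      (ln (f (r * s)%g) - ln (f (tperm i (r^-1%g j) * (r * s))%g)))
    / (#|I :\ i|)`!%:R.
  set K : R := _`!%:R.
  have K_gt0 : 0 < K by rewrite ltr0n fact_gt0.
  have sum_gt0 t : 0 < \sum_(r : 'S_n | perm_on (I :\ i) r) f (r * t)%g.
    rewrite (bigD1 1%g) ?perm_on1//= ltr_wpDr//.
    by apply: sumr_ge0 => r _; exact/ltW.
  rewrite /g /sym_avg !ln_div ?posrE// -/K opprB addrA subrK mulrAC.
  rewrite ler_pM2r ?invr_gt0//.
  have := @log_sum R _ (fun r => perm_on (I :\ i) r) 1%g
    (fun r => f (r * s)%g) (fun r => f (r * (tperm i j * s))%g) (perm_on1 _)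
    (fun=> f_gt0 _) (fun=> f_gt0 _).
  move=> /le_trans; apply.
  rewrite le_eqVlt; apply/orP; left; apply/eqP.
  apply: eq_bigr => r rI.
  have ri : (r^-1)%g i = i by rewrite (out_perm (perm_onV rI))// !inE eqxx.
  have -> : tperm i ((r^-1)%g j) = (r * tperm i j * r^-1)%g.
    by rewrite -[in LHS]ri -tpermJ /conjg invgK mulgA.
  by rewrite !mulgA mulgKV.
apply: le_trans (ler_sum _ (fun s _ => jensen s)) _.
rewrite exchange_big/=.
apply: le_trans (ler_sum _ (fun j _ => ler_sum _ (fun s _ => logsum j s))) _.
set K : R := _`!%:R.
pose G r j s := f (r * s)%g *
  (ln (f (r * s)%g) - ln (f (tperm i (r^-1%g j) * (r * s))%g)).
have -> : \sum_(j in I) \sum_s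
    (\sum_(r : 'S_n | perm_on (I :\ i) r) G r j s) / K =
    (\sum_(r : 'S_n | perm_on (I :\ i) r) \sum_(j in I) \sum_s G r j s) / K.
  rewrite [in RHS]exchange_big/= mulr_suml; apply: eq_bigr => j _.
  by rewrite [in RHS]exchange_big/= mulr_suml.
have inner r : perm_on (I :\ i) r -> 
    \sum_(j in I) \sum_s f (r * s)%g *
      (ln (f (r * s)%g) - ln (f (tperm i (r^-1%g j) * (r * s))%g)) =
    \sum_(j in I) tperm_entropy f i j.
  move=> rI; rewrite (reindex_inj (@perm_inj _ r))/=.
  apply: eq_big => [j|j _]; first by rewrite perm_closed// subI.
  by rewrite permK [RHS](reindex_inj (mulgI r)).
by rewrite (eq_bigr _ inner) sumr_const card_perm -mulr_natr mulfK.
Qed.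

Lemma tperm_entropy_id f i : tperm_entropy f i i = 0.
Proof.
by rewrite /tperm_entropy big1// => s _; rewrite tperm1 mul1g subrr mulr0.
Qed.

Lemma tperm_entropy_ge0 f i j : (forall s, 0 < f s) -> 0 <= tperm_entropy f i j.
Proof.
move=> f_gt0.
have := @log_sum R _ predT 1%g f (fun s => f (tperm i j * s)%g) erefl f_gt0
  (fun=> f_gt0 _).
have -> : \sum_s f (tperm i j * s)%g = \sum_s f s.
  by rewrite [RHS](reindex_inj (mulgI (tperm i j))).
by rewrite subrr mulr0.
Qed.

(** Modified logarithmic Sobolev inequality.  Entropy splits as the entropy given
    position [i] plus that of releasing [i]; averaging this over [i] in [I], with
    [M = #|I|], the coefficients [(M - 2) / (M - 1)] and [1 / M] that come out of
    the two parts add up to less than 1, which closes the induction. *)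
Lemma mlsi_on I f : (forall s, 0 < f s) -> (0 < #|I|)%N ->
  #|I|%:R * (\sum_s f s * (ln (f s) - ln (sym_avg I f s))) <=
  \sum_(i in I) \sum_(j in I) tperm_entropy f i j.
Proof.
move=> f_gt0; have [m] := ubnP #|I|.
elim: m I => // m IHm I; rewrite ltnS => Im I_gt0.
have psi_ge0 i j := tperm_entropy_ge0 i j f_gt0.
have [I1|I1] := eqVneq #|I| 1%N.
  rewrite big1 ?mulr0; last first.
    by move=> s _; rewrite sym_avg_card1// subrr mulr0.
  by apply: sumr_ge0 => i _; apply: sumr_ge0.
have I_gt1 : (1 < #|I|)%N by rewrite ltn_neqAle eq_sym I1.
set M : R := #|I|%:R; set T := (X in _ <= X).
have M_gt1 : 1 < M by rewrite ltr1n.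
have step i : i \in I ->
    \sum_s f s * (ln (f s) - ln (sym_avg I f s)) <=
    (\sum_(k in I :\ i) \sum_(l in I :\ i) tperm_entropy f k l) / (M - 1) +
    (\sum_(j in I) tperm_entropy f i j) / M.
  move=> iI.
  have cI : #|I| = #|I :\ i|.+1 by rewrite [LHS](cardsD1 i) iI.
  have M1 : M - 1 = #|I :\ i|%:R by rewrite /M cI -natr1 addrK.
  have ih : \sum_s f s * (ln (f s) - ln (sym_avg (I :\ i) f s)) <=
      (\sum_(k in I :\ i) \sum_(l in I :\ i) tperm_entropy f k l) / (M - 1).
    rewrite ler_pdivlMr ?subr_gt0// M1 mulrC; apply: IHm.
      by rewrite -cI.
    by move: I_gt1; rewrite cI.
  apply: le_trans (lerD ih (sym_avg_entropy_le iI f_gt0)).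
  rewrite -big_split/= le_eqVlt; apply/orP; left; apply/eqP.
  by apply: eq_bigr => s _; rewrite -mulrDr addrA subrK.
(* Dropping [i] from both index sets removes one row and one column of terms,
   whose common entry is zero. *)
have split_off i : i \in I ->
    \sum_(k in I :\ i) \sum_(l in I :\ i) tperm_entropy f k l =
    T - \sum_(j in I) tperm_entropy f i j - \sum_(j in I) tperm_entropy f j i.
  move=> iI; have TE : T = \sum_(j in I) tperm_entropy f i j +
      (\sum_(k in I :\ i) \sum_(l in I :\ i) tperm_entropy f k l +
       \sum_(k in I :\ i) tperm_entropy f k i).
    rewrite /T (big_setD1 i iI)/= -big_split; congr (_ + _).
    by apply: eq_bigr => k _; rewrite (big_setD1 i iI)/= addrC.
  by rewrite TE [X in _ - X](big_setD1 i iI)/= tperm_entropy_id; ring.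
have T_ge0 : 0 <= T by apply: sumr_ge0 => i _; apply: sumr_ge0.
set E := \sum_s _ in step *.
have -> : M * E = \sum_(i in I) E by rewrite sumr_const mulr_natl.
apply: le_trans (ler_sum _ step) _.
rewrite big_split/= -!mulr_suml (eq_bigr _ split_off) !sumrB sumr_const.
rewrite -/T [X in _ - X]exchange_big/= -/T -mulr_natl -/M.
have M0 : 0 < M by lra.
have -> : (M * T - T - T) / (M - 1) + T / M = T - T / (M * (M - 1)).
  by field; rewrite subr_eq0 !gt_eqF.
by rewrite gerBl divr_ge0// mulr_ge0; lra.
Qed.

End SymAvg.

(** * The Herbst argument *)

Section Herbst.
Variables (R : realType) (T : finType) (x0 : T) (g : T -> R).
Implicit Types a t : R.

Definition mgf t : R := (\sum_s expR (t * g s)) / #|T|%:R.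

Definition dmgf t : R := (\sum_s g s * expR (t * g s)) / #|T|%:R.

Let card_gt0R : 0 < #|T|%:R :> R.
Proof. by rewrite ltr0n; apply/card_gt0P; exists x0. Qed.

Lemma mgf_gt0 t : 0 < mgf t.
Proof.
rewrite divr_gt0// (bigD1 x0)//= ltr_wpDr ?expR_gt0//.
by apply: sumr_ge0 => s _; exact: expR_ge0.
Qed.

Lemma mgf0 : mgf 0 = 1.
Proof.
rewrite /mgf; under eq_bigr do rewrite mul0r expR0.
by rewrite sumr_const divff ?gt_eqF.
Qed.

Lemma is_derive_mgf t : is_derive t 1 mgf (dmgf t).
Proof.
have exp_derive s :
    is_derive t 1 (fun u => expR (u * g s)) (g s * expR (t * g s)).
  have lin : is_derive t 1 (fun u : R => u * g s) (g s).
    have := is_deriveM (is_derive_id t 1) (is_derive_cst (g s) t 1).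
    by rewrite scaler0 add0r /GRing.scale/= mulr1.
  rewrite mulrC.
  exact: (@is_derive1_comp R expR (fun u => u * g s)).
have sum_derive (r : seq T) :
    is_derive t 1 (fun u => \sum_(s <- r) expR (u * g s))
      (\sum_(s <- r) g s * expR (t * g s)).
  elim: r => [|s r IHr].
    rewrite big_nil; under eq_fun do rewrite big_nil; exact: is_derive_cst.
  rewrite big_cons; under eq_fun do rewrite big_cons.
  exact: is_deriveD.
have := is_deriveM (sum_derive (index_enum T))
  (is_derive_cst (#|T|%:R^-1 : R) t 1).
by rewrite scaler0 add0r /GRing.scale/= [X in is_derive _ _ _ X]mulrC.
Qed.

(** The hypothesis says that [phi t = (1 / t - a) * ln (mgf t)] has nonpositive
    derivative away from 0.  At 0, [phi] tends to the derivative of [ln \o mgf]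
    from both sides, so the monotonicity on the two half-lines can be chained.
    Taking [t1] and [t2] on both sides of 0 relates the lower tail of [g] to its
    upper tail without mentioning its mean. *)
Lemma herbst a t1 t2 : t1 < 0 -> 0 < t2 ->
  (forall t, t1 <= t <= t2 ->
    t * dmgf t - mgf t * ln (mgf t) <= a * t ^+ 2 * dmgf t) ->
  (t2^-1 - a) * ln (mgf t2) <= (t1^-1 - a) * ln (mgf t1).
Proof.
move=> t1_lt0 t2_gt0 ent_le.
pose G t := ln (mgf t); pose phi t := (t^-1 - a) * G t.
have dG t : is_derive t 1 G ((mgf t)^-1 * dmgf t).
  apply: (@is_derive1_comp R (@ln R) mgf).
    exact/is_derive1_ln/mgf_gt0.
  exact: is_derive_mgf.
have dphi t : t != 0 -> is_derive t 1 phi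
    ((t^-1 - a) * ((mgf t)^-1 * dmgf t) - G t * t ^- 2).
  move=> t_neq0; have dinv : is_derive t 1 (fun u : R => u^-1 - a) (- t ^- 2).
    have := is_deriveB (@is_deriveV R id t 1 1 t_neq0 (is_derive_id t 1))
      (is_derive_cst a t 1).
    by rewrite subr0 /GRing.scale/= mulr1.
  have := is_deriveM dinv (dG t).
  by rewrite /GRing.scale/= mulrN.
have phi_le t t' : t1 <= t -> t' <= t2 -> t < t' -> 0 < t * t' ->
    phi t' <= phi t.
  move=> t1t t't2 tt' tt'_gt0.
  have neq0 u : t <= u <= t' -> u != 0.
    by move=> /andP[tu ut']; apply/eqP => u0; nra.
  have [c cI phiE] : exists2 c, c \in `]t, t'[ & phi t' - phi t =
      ((c^-1 - a) * ((mgf c)^-1 * dmgf c) - G c * c ^- 2) * (t' - t).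
    apply: MVT => //.
      move=> u; rewrite in_itv/= => /andP[tu ut']; apply: dphi.
      by apply: neq0; rewrite !ltW.
    apply: derivable_within_continuous => u; rewrite in_itv/= => uI.
    exact: (@ex_derive _ _ _ _ _ _ _ (dphi u (neq0 u uI))).
  rewrite -subr_le0 phiE; move: cI; rewrite in_itv/= => /andP[tc ct'].
  have c_neq0 : c != 0 by apply: neq0; rewrite !ltW.
  apply: mulr_le0_ge0; last by rewrite subr_ge0 ltW.
  rewrite subr_le0.
  have F_gt0 := mgf_gt0 c.
  have c2_gt0 : 0 < c ^+ 2 by rewrite exprn_even_gt0.
  rewrite ler_pdivlMr// -(ler_pM2l F_gt0).
  have -> : mgf c * ((c^-1 - a) * ((mgf c)^-1 * dmgf c) * c ^+ 2) =
      c * dmgf c - a * c ^+ 2 * dmgf c.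
    by field; rewrite c_neq0 gt_eqF.
  have := ent_le c; rewrite (le_trans t1t (ltW tc)) (le_trans (ltW ct') t't2).
  by rewrite -/(G c) => /(_ isT); lra.
(* [ln (mgf h) / h] is the difference quotient at 0, since [ln (mgf 0) = 0]. *)
have phi0 : phi t @[t --> 0^'] --> dmgf 0.
  have G0 : G 0 = 0 by rewrite /G mgf0 ln1.
  have [G_drv G'0] := dG 0.
  have quot : h^-1 * G h @[h --> 0^'] --> dmgf 0.
    rewrite mgf0 invr1 mul1r in G'0; rewrite -G'0.
    have quotE : (fun h => h^-1 *: ((G \o shift 0) (h *: 1) - G 0)) =
        (fun h => h^-1 * G h).
      by apply/funext => h; rewrite /= G0 subr0 addr0 /GRing.scale/= mulr1.
    by move: G_drv; rewrite /derivable /derive quotE.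
  have cont : G h @[h --> 0^'] --> (0 : R).
    rewrite -[X in _ --> X]G0; apply: cvg_within_filter.
    exact/differentiable_continuous/derivable1_diffP.
  rewrite -[X in _ --> X]subr0 -[X in _ - X](mulr0 a).
  under eq_fun do rewrite /phi mulrBl.
  by apply: cvgB => //; apply: cvgMr.
apply: (@le_trans _ _ (dmgf 0)).
  apply: (cvgr_to_ge (cvg_dnbhs_at_right phi0)).
  near=> t.
  have t_gt0 : 0 < t by near: t; exact: nbhs_right_gt.
  have tt2 : t < t2 by near: t; exact: nbhs_right_lt.
  by apply: phi_le => //; [lra | rewrite mulr_gt0].
apply: (cvgr_to_le (cvg_dnbhs_at_left phi0)).
near=> t.
have t_lt0 : t < 0 by near: t; exact: nbhs_left_lt.
have t1t : t1 < t by near: t; exact: nbhs_left_gt.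
by apply: phi_le => //; [lra | rewrite nmulr_rgt0].
Unshelve. all: by end_near. Qed.

End Herbst.

(** * Self-bounding functions on the symmetric group *)

(** Moves the increments into positive parts.  For [x = t * (a - b)] with [b <= a]
    it reads [x * (1 - expR (- x)) <= 2 * x ^+ 2], true for [x >= - 1/2]; this is
    where the range of [t] and the bound 2 on increments are tied together, and
    what makes the estimate valid for both signs of [t]. *)
Lemma mulr_expRB_le (R : realType) (t a b : R) : `|t| <= 4^-1 ->
  a - b <= 2 -> b - a <= 2 ->
  (expR (t * a) - expR (t * b)) * (t * (a - b)) <=
  2 * t ^+ 2 * (expR (t * a) * Num.max 0 (a - b) ^+ 2 +
                expR (t * b) * Num.max 0 (b - a) ^+ 2).
Proof.
move=> t_le; wlog ba : a b / b <= a.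
  move=> wlog_le ab2 ba2; have [/wlog_le|/ltW/wlog_le] := leP b a; first exact.
  move=> /(_ ba2 ab2); rewrite [X in _ <= _ * X]addrC.
  by apply: le_trans; rewrite le_eqVlt; apply/orP; left; apply/eqP; ring.
move=> ab2 _; rewrite (max_r (_ : 0 <= a - b)) ?subr_ge0//.
rewrite (max_l (_ : b - a <= 0)) ?subr_le0// expr0n mulr0 addr0.
pose x := t * (a - b).
have -> : expR (t * b) = expR (t * a) * expR (- x).
  by rewrite -expRD; congr expR; rewrite /x; ring.
have E0 : 0 < expR (t * a) := expR_gt0 _.
suff key : (1 - expR (- x)) * x <= 2 * x ^+ 2.
  rewrite -(ler_pM2l E0) in key; apply: le_trans (le_trans key _).
    by rewrite le_eqVlt; apply/orP; left; apply/eqP; rewrite /x; ring.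
  by rewrite le_eqVlt; apply/orP; left; apply/eqP; rewrite /x; ring.
have x_le : - 2^-1 <= x <= 2^-1.
  by move: t_le; rewrite ler_norml /x => /andP[t1 t2]; apply/andP; split; nra.
have [x0|x0] := leP 0 x.
  have : 1 + - x <= expR (- x) := expR_ge1Dx _.
  by nra.
have e1 : 1 + x <= expR x := expR_ge1Dx _.
have e2 : expR x * expR (- x) = 1 := expRxMexpNx_1 _.
have e3 : 0 < expR (- x) := expR_gt0 _.
have e4 : (1 + x) * expR (- x) <= 1 by rewrite -[leRHS]e2 ler_pM2r.
(* [1 <= (1 + x) * (1 - 2 * x)] for [x] between [- 1/2] and 0. *)
have e5 : expR (- x) <= 1 - 2 * x.
  move: x_le => /andP[x1 x2].
  have px : 0 < 1 + x by lra.
  by rewrite -(ler_pM2l px); nra.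
by nra.
Qed.

(** Doubling the left-hand side and exchanging [s] with its image under the
    transposition gives the symmetric form to which [mulr_expRB_le] applies. *)
Lemma tperm_entropy_expR_le (R : realType) (n : nat) (g : 'S_n -> R) (t : R)
    (i j : 'I_n) : `|t| <= 4^-1 ->
  (forall s, g s - g (tperm i j * s)%g <= 2) ->
  tperm_entropy (fun s => expR (t * g s)) i j <=
  2 * t ^+ 2 * \sum_s expR (t * g s) *
    Num.max 0 (g s - g (tperm i j * s)%g) ^+ 2.
Proof.
move=> t_le g_le2; pose tau s : 'S_n := (tperm i j * s)%g.
have tauK s : tau (tau s) = s by rewrite /tau mulgA tperm2 mul1g.
have sum_tau (F : 'S_n -> R) : \sum_s F (tau s) = \sum_s F s.
  by rewrite [RHS](reindex_inj (mulgI (tperm i j))).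
pose d s := t * (g s - g (tau s)).
pose K s := expR (t * g s) * Num.max 0 (g s - g (tau s)) ^+ 2.
have entE : tperm_entropy (fun s => expR (t * g s)) i j =
    \sum_s expR (t * g s) * d s.
  by apply: eq_bigr => s _; rewrite !expRK -mulrBr.
have dbl : \sum_s expR (t * g s) * d s + \sum_s expR (t * g s) * d s =
    \sum_s (expR (t * g s) - expR (t * g (tau s))) * d s.
  rewrite -{2}(sum_tau (fun s => expR (t * g s) * d s)) -big_split/=.
  by apply: eq_bigr => s _; rewrite /d tauK; ring.
have le_K s : (expR (t * g s) - expR (t * g (tau s))) * d s <=
    2 * t ^+ 2 * (K s + K (tau s)).
  rewrite /K tauK; have := g_le2 (tau s); rewrite -/(tau (tau s)) tauK => ba.
  by apply: mulr_expRB_le => //; exact: g_le2.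
rewrite entE -[X in _ <= _ * X]/(\sum_s K s).
have : \sum_s (expR (t * g s) - expR (t * g (tau s))) * d s <=
    \sum_s 2 * t ^+ 2 * (K s + K (tau s)) by apply: ler_sum => s _.
rewrite -dbl -mulr_sumr big_split/= sum_tau.
by lra.
Qed.

Lemma selfbounding_entropy_le (R : realType) (n : nat) (g : 'S_n -> R)
    (c t : R) : (0 < n)%N -> `|t| <= 4^-1 ->
  (forall i j s, g s - g (tperm i j * s)%g <= 2) ->
  (forall s, \sum_i \sum_j Num.max 0 (g s - g (tperm i j * s)%g) ^+ 2 <=
     n%:R * c * g s) ->
  t * dmgf g t - mgf g t * ln (mgf g t) <= 2 * c * t ^+ 2 * dmgf g t.
Proof.
move=> n_gt0 t_le g_le2 g_sb; pose f s := expR (t * g s).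
have f_gt0 s : 0 < f s by exact: expR_gt0.
have nR_gt0 : 0 < n%:R :> R by rewrite ltr0n.
have cardS : #|{: 'S_n}| = n`! by exact: card_Sn.
have := @mlsi_on R n [set: 'I_n]%SET f f_gt0.
rewrite cardsT card_ord => /(_ n_gt0) lsi.
have avgE s : sym_avg [set: 'I_n]%SET f s = mgf g t.
  by rewrite sym_avg_setT /mgf cardS.
pose N : R := n`!%:R; have N_gt0 : 0 < N by rewrite ltr0n fact_gt0.
have entE : \sum_s f s * (ln (f s) - ln (sym_avg [set: 'I_n]%SET f s)) =
    N * (t * dmgf g t - mgf g t * ln (mgf g t)).
  have -> : N * (t * dmgf g t - mgf g t * ln (mgf g t)) =
      t * (N * dmgf g t) - N * mgf g t * ln (mgf g t) by ring.
  have -> : N * dmgf g t = \sum_s g s * f s.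
    by rewrite /dmgf cardS mulrC divfK ?gt_eqF.
  have -> : N * mgf g t = \sum_s f s.
    by rewrite /mgf cardS mulrC divfK ?gt_eqF.
  rewrite mulr_sumr mulr_suml -sumrB; apply: eq_bigr => s _.
  by rewrite avgE /f expRK; ring.
rewrite entE in lsi.
rewrite -(ler_pM2l N_gt0) -(ler_pM2l nR_gt0); apply: le_trans lsi _.
have -> : n%:R * (N * (2 * c * t ^+ 2 * dmgf g t)) =
    2 * t ^+ 2 * \sum_s f s * (n%:R * c * g s).
  rewrite /dmgf cardS -/N; under [in RHS]eq_bigr do rewrite mulrCA.
  rewrite -mulr_sumr; under [in RHS]eq_bigr do rewrite mulrC.
  by field; rewrite gt_eqF.
apply: le_trans (_ : _ <= 2 * t ^+ 2 * \sum_s f s *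
    (\sum_i \sum_j Num.max 0 (g s - g (tperm i j * s)%g) ^+ 2)) _; last first.
  apply: ler_wpM2l; first by rewrite mulr_ge0// sqr_ge0.
  by apply: ler_sum => s _; rewrite ler_pM2l.
have -> : \sum_s f s *
    (\sum_i \sum_j Num.max 0 (g s - g (tperm i j * s)%g) ^+ 2) =
    \sum_i \sum_j \sum_s f s * Num.max 0 (g s - g (tperm i j * s)%g) ^+ 2.
  under eq_bigr do rewrite mulr_sumr.
  rewrite exchange_big; apply: eq_bigr => i _.
  under eq_bigr do rewrite mulr_sumr.
  by rewrite exchange_big.
rewrite mulr_sumr.
under eq_bigl do rewrite inE; apply: ler_sum => i _.
rewrite mulr_sumr; under eq_bigl do rewrite inE; apply: ler_sum => j _.
by apply: tperm_entropy_expR_le.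
Qed.

(** [herbst] between [- 1/4] and [1/144], where [1 / t - 56] equals [- 60] and
    [88]; since [60 <= 88] and the two logarithms have opposite signs, their sum
    is nonpositive. *)
Lemma selfbounding_mgf_le (R : realType) (n : nat) (g : 'S_n -> R) :
  (0 < n)%N -> (forall s, 0 <= g s) ->
  (forall i j s, g s - g (tperm i j * s)%g <= 2) ->
  (forall s, \sum_i \sum_j Num.max 0 (g s - g (tperm i j * s)%g) ^+ 2 <=
     n%:R * 28 * g s) ->
  mgf g (- 4^-1) * mgf g (144^-1) <= 1.
Proof.
move=> n_gt0 g_ge0 g_le2 g_sb.
have mgf_pos t : 0 < mgf g t by exact: (mgf_gt0 1%g).
have := @herbst R _ 1%g g 56 (- 4^-1) 144^-1.
have -> : - 4^-1 < 0 :> R by lra.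
have -> : 0 < 144^-1 :> R by lra.
move=> /(_ isT isT) h.
have {}h : (144^-1^-1 - 56) * ln (mgf g 144^-1) <=
    ((- 4^-1)^-1 - 56) * ln (mgf g (- 4^-1)).
  apply: h => t /andP[t1 t2].
  have -> : (56 : R) = 2 * 28 by lra.
  by apply: selfbounding_entropy_le => //; rewrite ler_norml; lra.
rewrite invrN !invrK in h.
have mgf_le1 : ln (mgf g (- 4^-1)) <= 0.
  apply: ln_le0; rewrite /mgf ler_pdivrMr; last first.
    by rewrite ltr0n; apply/card_gt0P; exists 1%g.
  rewrite mul1r -[leRHS]sumr_const; apply: ler_sum => s _.
  by rewrite expR_le1 mulNr oppr_le0 mulr_ge0.
have mgf_ge1 : 0 <= ln (mgf g 144^-1).
  apply: ln_ge0; rewrite /mgf ler_pdivlMr; last first.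
    by rewrite ltr0n; apply/card_gt0P; exists 1%g.
  rewrite mul1r -[leLHS]sumr_const; apply: ler_sum => s _.
  by rewrite -expR0 ler_expR mulr_ge0.
suff : ln (mgf g (- 4^-1) * mgf g 144^-1) <= ln 1.
  by rewrite ler_ln ?posrE ?ltr01//; exact: mulr_gt0.
by rewrite lnM ?posrE// ln1; lra.
Qed.

(** * The convex distance is self-bounding under transpositions *)

Definition permute (R : realType) (N : nat) (s : 'S_N) (w : 'rV[R]_N) :
    'rV[R]_N :=
  \row_k w ord0 (s k).

Lemma permuteM (R : realType) (N : nat) (s t : 'S_N) (w : 'rV[R]_N) :
  permute s (permute t w) = permute (s * t)%g w.
Proof. by apply/rowP => k; rewrite !mxE permM. Qed.

Section ConvexDist.
Variables (R : realType) (N : nat) (A : set 'rV[R]_N).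
Hypotheses (N_gt0 : (0 < N)%N) (A_neq0 : A !=set0).
Implicit Types (a w v : 'rV[R]_N) (i j k : 'I_N).

Let mism a w w' : R := \sum_i `|a ord0 i| * (w ord0 i != w' ord0 i)%:R.

Let cost a w : R := inf [set mism a w w' | w' in A].

Let mism_ge0 a w w' : 0 <= mism a w w'.
Proof. by apply: sumr_ge0 => i _; rewrite mulr_ge0. Qed.

Let cost_le a w w' : A w' -> cost a w <= mism a w w'.
Proof.
move=> Aw'; apply: ge_inf; last by exists w'.
by exists 0 => _ [u _ <-].
Qed.

Let le_cost a w x : (forall w', A w' -> x <= mism a w w') -> x <= cost a w.
Proof.
move=> x_le; apply: lb_le_inf => [|_ [w' Aw' <-]]; last exact: x_le.
by have [w' Aw'] := A_neq0; exists (mism a w w'), w'.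
Qed.

Let cost_ge0 a w : 0 <= cost a w.
Proof. exact: le_cost. Qed.

Let normsq_sum a : euclid_norm a ^+ 2 = \sum_i `|a ord0 i| ^+ 2.
Proof.
rewrite sqr_sqrtr; last by apply: sumr_ge0 => i _; exact: sqr_ge0.
by apply: eq_bigr => i _; rewrite real_normK ?num_real.
Qed.

Let norm_ge0 a : 0 <= euclid_norm a. Proof. exact: sqrtr_ge0. Qed.

Let cost_le_dist a w : euclid_norm a = 1 -> cost a w <= convex_dist w A.
Proof.
move=> a1; apply: ub_le_sup; last by exists a.
exists N%:R => _ [b b1 <-].
have [w' Aw'] := A_neq0; apply: le_trans (cost_le b w Aw') _.
rewrite -[N in N%:R]card_ord -sumr_const; apply: ler_sum => i _.
have b_le1 : `|b ord0 i| <= 1.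
  rewrite -(ler_pXn2r (ltn0Sn 1)) ?nnegrE// expr1n.
  have := normsq_sum b; rewrite b1 expr1n (bigD1 i)//= => ->.
  by rewrite lerDl; apply: sumr_ge0 => k _; exact: sqr_ge0.
by apply: le_trans b_le1; rewrite ler_piMr// lern1 leq_b1.
Qed.

Let unit_ex : exists a, euclid_norm a = 1.
Proof.
exists (delta_mx ord0 (Ordinal N_gt0)); rewrite /euclid_norm.
rewrite (bigD1 (Ordinal N_gt0))//= big1 => [|i ni].
  by rewrite mxE !eqxx expr1n addr0 sqrtr1.
by rewrite mxE eqxx (negbTE ni) expr0n.
Qed.

Let dist_le w x : (forall a, euclid_norm a = 1 -> cost a w <= x) ->
  convex_dist w A <= x.
Proof.
move=> x_ge; apply: ge_sup => [|_ [a a1 <-]]; last exact: x_ge.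
by have [a a1] := unit_ex; exists (cost a w), a.
Qed.

Lemma convex_dist_ge0 w : 0 <= convex_dist w A.
Proof. by have [a a1] := unit_ex; apply: le_trans (cost_le_dist w a1). Qed.

Lemma convex_dist_mem w : A w -> convex_dist w A = 0.
Proof.
move=> Aw; apply/eqP; rewrite eq_le convex_dist_ge0 andbT.
apply: dist_le => a _; apply: le_trans (cost_le a w Aw) _.
by rewrite /mism big1// => i _; rewrite eqxx mulr0.
Qed.

(** Homogeneity extends the bound by the convex distance from unit weights to all
    weights, which is needed for weights with erased coordinates. *)
Let cost_le_norm a w : cost a w <= euclid_norm a * convex_dist w A.
Proof.
have [a0|a_neq0] := eqVneq (euclid_norm a) 0.
  have a_eq0 i : `|a ord0 i| = 0.
    have := normsq_sum a; rewrite a0 expr0n => /esym/eqP.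
    rewrite psumr_eq0 => [/allP/(_ i)|k _]; last exact: sqr_ge0.
    by rewrite mem_index_enum sqrf_eq0 => /(_ isT)/eqP.
  rewrite a0 mul0r; have [w' Aw'] := A_neq0.
  apply: le_trans (cost_le a w Aw') _.
  by rewrite /mism big1// => i _; rewrite a_eq0 mul0r.
set r := euclid_norm a; have r_gt0 : 0 < r by rewrite lt0r a_neq0 norm_ge0.
pose b := r^-1 *: a.
have bE i : `|b ord0 i| = r^-1 * `|a ord0 i|.
  by rewrite mxE normrM ger0_norm// invr_ge0 ltW.
have b1 : euclid_norm b = 1.
  apply/eqP; rewrite -(@eqrXn2 _ 2)// expr1n normsq_sum.
  under eq_bigr do rewrite bE exprMn.
  by rewrite -mulr_sumr -normsq_sum -/r -exprMn mulVf ?expr1n.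
apply: le_trans (_ : r * cost b w <= _); last first.
  by rewrite ler_pM2l// cost_le_dist.
rewrite mulrC -ler_pdivrMr//; apply: le_cost => w' Aw'.
rewrite ler_pdivrMr//; apply: le_trans (cost_le a w Aw') _.
rewrite /mism mulr_suml le_eqVlt; apply/orP; left; apply/eqP.
by apply: eq_bigr => i _; rewrite bE; field; rewrite gt_eqF.
Qed.

Section TwoCoordinates.
Variables (w v : 'rV[R]_N) (i j : 'I_N).
Hypotheses (ij : i != j)
  (wv : forall k, k != i -> k != j -> w ord0 k = v ord0 k).

Let erase a : 'rV[R]_N :=
  \row_k (if (k == i) || (k == j) then 0 else a ord0 k).

Let sum_erase (F : 'I_N -> R) :
  \sum_k F k = F i + F j + \sum_(k | ~~ ((k == i) || (k == j))) F k.
Proof.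
rewrite (bigD1 i)//= (bigD1 j) ?[j == i]eq_sym//= addrA; congr (_ + _).
by apply: eq_bigl => k; rewrite negb_or.
Qed.

Let cost_erase_le a :
  cost a w <= cost (erase a) v + (`|a ord0 i| + `|a ord0 j|).
Proof.
rewrite -lerBlDr; apply: le_cost => w' Aw'; rewrite lerBlDr.
apply: le_trans (cost_le a w Aw') _.
rewrite /mism !sum_erase !mxE !eqxx orbT/= normr0 !mul0r !add0r addrC.
apply: lerD; last by apply: lerD; rewrite ler_piMr// lern1 leq_b1.
apply: ler_sum => k kij; rewrite mxE (negbTE kij) wv//;
  by move: kij; rewrite negb_or => /andP[].
Qed.

Let cost_erase_ge a : cost (erase a) v <= cost a v.
Proof.
apply: le_cost => w' Aw'; apply: le_trans (cost_le _ _ Aw') _.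
apply: ler_sum => k _; rewrite mxE ler_wpM2r//.
by case: ifP => // _; rewrite normr0.
Qed.

(** The weight [a] is nearly optimal for [w] and does not depend on [i], [j] and
    [v], so that one weight serves all transpositions of [w] at once. *)
Lemma convex_dist_near_max_le a e : convex_dist w A - e <= cost a w ->
  euclid_norm a = 1 ->
  convex_dist w A <= convex_dist v A + (`|a ord0 i| + `|a ord0 j|) + e.
Proof.
move=> near a1; have := cost_erase_le a; have := cost_erase_ge a.
by have := cost_le_dist v a1; lra.
Qed.

(** With [b] the norm of the weight off [i] and [j], and [p], [q] its two
    coordinates there, the cost of [w] is at most [b * d + p + q]; the vectors
    [(b, p, q)] and [(d, 1, 1)] have squared norms [1] and [d ^+ 2 + 2]. *)
Lemma convex_dist_sq_le : convex_dist w A ^+ 2 <= convex_dist v A ^+ 2 + 2.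
Proof.
set d := convex_dist v A.
have d2 : 0 <= d ^+ 2 + 2 by rewrite addr_ge0// sqr_ge0.
suff le_sqrt : convex_dist w A <= Num.sqrt (d ^+ 2 + 2).
  rewrite -(sqr_sqrtr d2) ler_pXn2r ?nnegrE ?sqrtr_ge0//.
  exact: convex_dist_ge0.
apply: dist_le => a a1.
set p := `|a ord0 i|; set q := `|a ord0 j|; set b := euclid_norm (erase a).
have a_split : b ^+ 2 + p ^+ 2 + q ^+ 2 = 1.
  have := normsq_sum a; rewrite a1 expr1n sum_erase => ->.
  rewrite /b normsq_sum sum_erase !mxE !eqxx orbT normr0 expr0n !add0r.
  rewrite -addrA addrC; congr (_ + _).
  by apply: eq_bigr => k kij; rewrite mxE (negbTE kij).
have cost_le_bd : cost a w <= b * d + (p + q).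
  by apply: le_trans (cost_erase_le a) _; rewrite lerD2r cost_le_norm.
apply: le_trans cost_le_bd _; rewrite -[leLHS]ger0_norm; last first.
  have bd_ge0 : 0 <= b * d by rewrite mulr_ge0 ?norm_ge0 ?convex_dist_ge0.
  have p_ge0 : 0 <= p := normr_ge0 _.
  by have q_ge0 : 0 <= q := normr_ge0 _; lra.
rewrite -sqrtr_sqr ler_wsqrtr//.
have -> : d ^+ 2 + 2 = (b ^+ 2 + p ^+ 2 + q ^+ 2) * (d ^+ 2 + 2).
  by rewrite a_split mul1r.
(* Lagrange's identity for the two vectors. *)
have := sqr_ge0 (b - p * d); have := sqr_ge0 (b - q * d).
have := sqr_ge0 (p - q); lra.
Qed.

End TwoCoordinates.

Let permute_tperm_out i j w k : k != i -> k != j ->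
  w ord0 k = permute (tperm i j) w ord0 k.
Proof. by move=> ki kj; rewrite mxE tpermD// eq_sym. Qed.

Let permute_tperm_id i w : permute (tperm i i) w = w.
Proof. by apply/rowP => k; rewrite mxE tperm1 perm1. Qed.

Lemma convex_dist_sq_tperm_le i j w :
  convex_dist w A ^+ 2 - convex_dist (permute (tperm i j) w) A ^+ 2 <= 2.
Proof.
have [<-|ij] := eqVneq i j; first by rewrite permute_tperm_id subrr.
by rewrite lerBlDl; exact: (convex_dist_sq_le ij (@permute_tperm_out i j w)).
Qed.

(** With a weight [a] optimal up to [e], the positive part of the increment of
    [d ^+ 2] is at most [2 * d * (|a_i| + |a_j| + e)].  The squares of these add
    up to at most [12 * d ^+ 2 * (2 N + N ^ 2 * e ^+ 2)], and [e = 1 / (2 N)]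
    brings the constant below 28. *)
Lemma convex_dist_sq_selfbounding w :
  \sum_i \sum_j
    Num.max 0
      (convex_dist w A ^+ 2 - convex_dist (permute (tperm i j) w) A ^+ 2) ^+ 2 <=
  N%:R * 28 * convex_dist w A ^+ 2.
Proof.
set d := convex_dist w A; have d_ge0 : 0 <= d := convex_dist_ge0 w.
have NR : 1 <= N%:R :> R by rewrite ler1n.
pose e : R := (2 * N%:R)^-1.
have e_gt0 : 0 < e by rewrite invr_gt0; lra.
have [a a1 near_a] : exists2 a, euclid_norm a = 1 & d - e <= cost a w.
  have [] := @sup_adherent R [set cost a w | a in [set a | euclid_norm a = 1]] e
    e_gt0.
    split; first by have [a a1] := unit_ex; exists (cost a w), a.
    by exists d => _ [a a1 <-]; exact: cost_le_dist.
  by move=> _ [a a1 <-] /ltW ?; exists a.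
pose c i := `|a ord0 i|.
have term_le i j :
    Num.max 0 (d ^+ 2 - convex_dist (permute (tperm i j) w) A ^+ 2) ^+ 2 <=
    12 * d ^+ 2 * (c i ^+ 2 + c j ^+ 2 + e ^+ 2).
  set d' := convex_dist (permute (tperm i j) w) A.
  have d'_ge0 : 0 <= d' := convex_dist_ge0 _.
  have ci : 0 <= c i by rewrite /c.
  have cj : 0 <= c j by rewrite /c.
  have dd' : d <= d' + (c i + c j) + e.
    rewrite /d'; have [<-|ij] := eqVneq i j.
      by rewrite permute_tperm_id -/d; lra.
    exact: (convex_dist_near_max_le ij (@permute_tperm_out i j w) near_a a1).
  have max_le : Num.max 0 (d ^+ 2 - d' ^+ 2) <= 2 * d * (c i + c j + e).
    have S_ge0 : 0 <= c i + c j + e by lra.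
    have gap_ge0 : 0 <= d' + (c i + c j + e) - d by lra.
    (* [2 * d * S - (d ^+ 2 - d' ^+ 2) = 2 * d * (S - (d - d')) + (d - d') ^+ 2]. *)
    have := mulr_ge0 d_ge0 gap_ge0; have := mulr_ge0 d_ge0 S_ge0.
    by have := sqr_ge0 (d - d'); rewrite ge_max => *; apply/andP; split; lra.
  have max_ge0 : 0 <= Num.max 0 (d ^+ 2 - d' ^+ 2) by rewrite le_max lexx.
  apply: (@le_trans _ _ ((2 * d * (c i + c j + e)) ^+ 2)).
    by rewrite ler_pXn2r ?nnegrE//; apply: le_trans max_le.
  have -> : (2 * d * (c i + c j + e)) ^+ 2 =
    4 * d ^+ 2 * (c i + c j + e) ^+ 2 by ring.
  have -> : 12 * d ^+ 2 * (c i ^+ 2 + c j ^+ 2 + e ^+ 2) =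
    4 * d ^+ 2 * (3 * (c i ^+ 2 + c j ^+ 2 + e ^+ 2)) by ring.
  apply: ler_wpM2l; first by rewrite mulr_ge0// sqr_ge0.
  have := sqr_ge0 (c i - c j); have := sqr_ge0 (c i - e).
  by have := sqr_ge0 (c j - e); lra.
apply: (@le_trans _ _
  (\sum_i \sum_j 12 * d ^+ 2 * (c i ^+ 2 + c j ^+ 2 + e ^+ 2))).
  by apply: ler_sum => i _; apply: ler_sum => j _; exact: term_le.
have c_sum : \sum_i c i ^+ 2 = 1 by rewrite -normsq_sum a1 expr1n.
have -> : \sum_i \sum_j 12 * d ^+ 2 * (c i ^+ 2 + c j ^+ 2 + e ^+ 2) =
    12 * d ^+ 2 * (2 * N%:R + N%:R ^+ 2 * e ^+ 2).
  have inner i : \sum_j 12 * d ^+ 2 * (c i ^+ 2 + c j ^+ 2 + e ^+ 2) =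
      12 * d ^+ 2 * (N%:R * c i ^+ 2 + 1 + N%:R * e ^+ 2).
    rewrite -mulr_sumr !big_split/= !sumr_const card_ord c_sum.
    by rewrite -[_ ^+ 2 *+ N]mulr_natl -[e ^+ 2 *+ N]mulr_natl.
  rewrite (eq_bigr _ (fun i _ => inner i)) -mulr_sumr !big_split/= -mulr_sumr.
  by rewrite c_sum !sumr_const card_ord -[_ * e ^+ 2 *+ N]mulr_natl; ring.
have Ne : N%:R * e = 2^-1 by rewrite /e; field; rewrite gt_eqF//; lra.
rewrite -exprMn Ne.
have d2N : 0 <= d ^+ 2 * (N%:R - 1) by rewrite mulr_ge0 ?sqr_ge0// subr_ge0.
by have := sqr_ge0 d; lra.
Qed.

End ConvexDist.

(** * The multislice as an orbit of the symmetric group *)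

Section Multislice.
Variables (R : realType) (L N : nat) (kappa : 'I_L -> nat) (x : 'I_L -> R).
Implicit Types (w : 'rV[R]_N) (s t : 'S_N) (F : 'rV[R]_N -> R).

Local Notation Omega := (multislice (N := N) kappa x).

Let permute_inj s : injective (@permute R N s).
Proof.
move=> w w' /rowP ww'; apply/rowP => k.
by have := ww' (s^-1%g k); rewrite !mxE permKV.
Qed.

Let multislice_permute s w : Omega w -> Omega (permute s w).
Proof.
move=> [w_x w_kappa]; split => [k|l]; first by rewrite mxE.
rewrite -w_kappa -!sum1_card [RHS](reindex_inj (@perm_inj _ s))/=.
by apply: eq_bigl => k; rewrite !inE mxE.
Qed.

(** Two words with the same letter counts are permutations of each other; letters
    outside the alphabet occur in neither. *)
Lemma multislice_transitive w w' : Omega w -> Omega w' ->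
  exists s, w' = permute s w.
Proof.
move=> [w_x w_kappa] [w'_x w'_kappa].
have countE (v : 'rV[R]_N) u : count_mem u [tuple v ord0 k | k < N] =
    #|[pred k | v ord0 k == u]| :> nat.
  rewrite /= count_map cardE -size_filter enumT.
  by rewrite /enum_mem.
have : perm_eq [tuple w' ord0 k | k < N] [tuple w ord0 k | k < N].
  apply/allP => u; rewrite mem_cat /= => u_in.
  have [l _ <-] : range x u.
    by case/orP: u_in => /mapP[k _ ->]; [exact: w'_x|exact: w_x].
  by rewrite /= !countE w_kappa w'_kappa.
move=> /tuple_permP[s sE]; exists s; apply/rowP => k; rewrite mxE.
have /val_inj/(congr1 (fun z : N.-tuple R => tnth z k)) := sE.
by rewrite !tnth_mktuple.
Qed.

(** Sum [F (permute s v)] over both [s] and [v]: for fixed [s], permuting is a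
    bijection of the multislice; for fixed [v], transitivity makes the sum over
    [s] independent of [v].  This avoids counting stabilizers. *)
Lemma unif_expect_multislice F w : Omega w ->
  unif_expect Omega F = (\sum_s F (permute s w)) / #|{: 'S_N}|%:R.
Proof.
move=> Ow; have fO := @finite_multislice R L N kappa x.
rewrite /unif_expect fsbig_finite//=; set E := fset_set Omega.
have memE v : (v \in E) = (v \in Omega) by rewrite in_fset_set.
have E_gt0 : 0 < #|` E|%:R :> R.
  by rewrite ltr0n cardfs_gt0; apply/fset0Pn; exists w; rewrite memE inE.
have S_gt0 : 0 < #|{: 'S_N}|%:R :> R.
  by rewrite ltr0n; apply/card_gt0P; exists 1%g.
have orbit_sum v : v \in E -> \sum_s F (permute s v) = \sum_s F (permute s w).
  rewrite memE inE => /(multislice_transitive Ow)[t ->].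
  rewrite [RHS](reindex_inj (mulIg t)); apply: eq_bigr => s _.
  by rewrite permuteM.
have shift_sum s : \sum_(v <- E) F (permute s v) = \sum_(v <- E) F v.
  rewrite -(big_map (permute s) xpredT F); apply: perm_big.
  have map_uniq : uniq [seq permute s v | v <- E].
    by rewrite map_inj_uniq ?fset_uniq//; exact: permute_inj.
  apply: uniq_perm => //; first exact: fset_uniq.
  apply: (uniq_min_size map_uniq _ _).2; last by rewrite size_map.
  move=> _ /mapP[v vE ->]; move: vE; rewrite !memE !inE.
  exact: multislice_permute.
have key : (\sum_(v <- E) F v) * #|{: 'S_N}|%:R =
    (\sum_s F (permute s w)) * #|` E|%:R.
  transitivity (\sum_s \sum_(v <- E) F (permute s v)).
    by rewrite (eq_bigr _ (fun s _ => shift_sum s)) sumr_const mulr_natr.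
  rewrite exchange_big/= big_seq (eq_bigr _ orbit_sum) -big_seq.
  by rewrite big_const_seq count_predT iter_addr_0 mulr_natr.
by apply/eqP; rewrite eqr_div ?lt0r_neq0// key.
Qed.

(** Markov's inequality in the form used for [F = expR (- g / 4)], which is 1 on
    [A] because the distance vanishes there. *)
Lemma unif_prob_le_expect (A : set 'rV[R]_N) F : A `<=` Omega ->
  (forall w, 0 <= F w) -> (forall w, A w -> F w = 1) ->
  unif_prob R Omega A <= unif_expect Omega F.
Proof.
move=> AO F_ge0 F1; have fO := @finite_multislice R L N kappa x.
rewrite /unif_prob /unif_expect (setIidl AO) fsbig_finite//=.
have fA : finite_set A := sub_finite_set AO fO.
apply: ler_wpM2r; first by rewrite invr_ge0.
rewrite (bigID (fun w => w \in fset_set A))/= -[leLHS]addr0.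
apply: lerD; last by apply: sumr_ge0.
rewrite -big_filter; set r := [seq _ <- _ | _].
rewrite big_seq (eq_bigr (fun=> 1)); last first.
  move=> w; rewrite mem_filter => /andP[wA _]; apply: F1.
  by move: wA; rewrite in_fset_set// inE.
rewrite -big_seq big_const_seq count_predT iter_addr_0 ler_nat.
apply: uniq_leq_size; first exact: fset_uniq.
move=> w wA; have Aw : A w by move: wA; rewrite in_fset_set// inE.
by rewrite mem_filter wA/= in_fset_set// inE; exact: AO.
Qed.

End Multislice.

Theorem proposition1p7 (R : realType) (L N : nat) (kappa : 'I_L -> nat)
    (x : 'I_L -> R) (A : set 'rV[R]_N) :
  (2 <= L)%N ->
  (forall l, (0 < kappa l)%N) ->
  N = (\sum_(l < L) kappa l)%N ->
  injective x ->
  A `<=` multislice kappa x ->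
  unif_prob R (multislice kappa x) A *
    unif_expect (multislice kappa x)
      (fun w => expR (convex_dist w A ^+ 2 / 144%:R)) <= 1.
Proof.
move=> L_ge2 kappa_gt0 N_sum _ AO.
have N_gt0 : (0 < N)%N.
  rewrite N_sum (bigD1 (Ordinal L_ge2))//= addn_gt0.
  by rewrite kappa_gt0.
have [->|/set0P A_neq0] := eqVneq A set0.
  by rewrite /unif_prob set0I fset_set0 cardfs0 mul0r mul0r.
have [w Aw] := A_neq0; have Ow := AO _ Aw.
pose g (s : 'S_N) := convex_dist (permute s w) A ^+ 2.
have := @selfbounding_mgf_le R N g N_gt0 (fun=> sqr_ge0 _).
have g_le2 i j s : g s - g (tperm i j * s)%g <= 2.
  by rewrite /g -permuteM; exact: convex_dist_sq_tperm_le.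
have g_sb s : \sum_i \sum_j Num.max 0 (g s - g (tperm i j * s)%g) ^+ 2 <=
    N%:R * 28 * g s.
  under eq_bigr do under eq_bigr do rewrite /g -permuteM.
  exact: convex_dist_sq_selfbounding.
move=> /(_ g_le2 g_sb); apply: le_trans.
rewrite (unif_expect_multislice _ Ow).
have -> : (\sum_s expR (convex_dist (permute s w) A ^+ 2 / 144)) /
    #|{: 'S_N}|%:R = mgf g 144^-1.
  by congr (_ / _); apply: eq_bigr => s _; rewrite mulrC.
apply: ler_wpM2r; first exact/ltW/(mgf_gt0 1%g).
apply: le_trans (@unif_prob_le_expect _ _ _ _ _ _
  (fun v => expR (- 4^-1 * convex_dist v A ^+ 2)) AO _ _) _.
- by move=> v; exact: expR_ge0.
- move=> v Av; rewrite convex_dist_mem//.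
  by rewrite expr0n mulr0 expR0.
- by rewrite (unif_expect_multislice _ Ow).
Qed.
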